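(* Let $X$ be a uniformly convex complex Banach space and let $Y$ be a $\mathbb{C}$-uniformly convex complex Banach space. Then the pair $(c_0(X),Y)$ has the Bishop-Phelps-Bollobás property for operators. That is, for each $\varepsilon>0$ there exists $\eta(\varepsilon)>0$ such that whenever $T\in S_{\mathcal{L}(c_0(X),Y)}$ and $x_0\in S_{c_0(X)}$ satisfy $\|Tx_0\|>1-\eta(\varepsilon)$, there exist $S\in S_{\mathcal{L}(c_0(X),Y)}$ and $z_0\in S_{c_0(X)}$ with $$\|Sz_0\|=1,\quad \|S-T\|<\varepsilon\quad\text{and}\quad \|z_0-x_0\|<\varepsilon.$$
   Context: For a Banach space $Z$, $B_Z$ and $S_Z$ denote its closed unit ball and unit sphere. $\mathcal{L}(Z,Y)$ is the space of bounded linear operators from $Z$ to $Y$ with the operator norm. $c_0(X)=\bigl[\oplus_{i=1}^\infty X\bigr]_{c_0}$ is the space of sequences $x=(x(i))_{i\in\mathbb{N}}$ in $X$ with $\|x(i)\|\to 0$, normed by $\|x\|=\sup_i\|x(i)\|$. A Banach space $X$ is uniformly convex if for every $\varepsilon>0$ there is $\delta(\varepsilon)>0$ such that $1-\left\|\frac{x+y}{2}\right\|\ge\delta(\varepsilon)$ whenever $x,y\in B_X$ and $\|x-y\|\ge\varepsilon$. A complex Banach space $Y$ is $\mathbb{C}$-uniformly convex if for every $\varepsilon>0$ the modulus of $\mathbb{C}$-convexity $$\delta_{\mathbb{C}}(\varepsilon):=\inf_{x,y\in S_Y}\Bigl\{\sup_{\lambda\in\mathbb{C},\,|\lambda|=1}\|x+\lambda\varepsilon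 y\|-1\Bigr\}$$ is strictly positive. *)

(* Defs.v *)
From HB Require Import structures.
From mathcomp Require Import all_boot all_order all_algebra.
From mathcomp Require Import complex.
From mathcomp Require Import all_classical all_reals all_analysis.

Set Implicit Arguments.
Unset Strict Implicit.
Unset Printing Implicit Defensive.

Import Order.TTheory GRing.Theory Num.Theory.
Import numFieldNormedType.Exports.

Local Open Scope classical_set_scope.
Local Open Scope ring_scope.
Local Open Scope complex_scope.

(* Norms of complex normed modules take values in R[i]; [rnorm x] is the same
   number seen in R, see [rnormE]. *)
Definition rnorm (R : realType) (Z : normedModType R[i]) (z : Z) : R :=
  complex.Re `|z|.

Definition unit_ball (R : realType) (Z : normedModType R[i]) : set Z :=
  [set z | `|z| <= 1].

Definition unit_sphere (R : realType) (Z : normedModType R[i]) : set Z :=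
  [set z | `|z| = 1].

Arguments unit_ball {R} Z _.
Arguments unit_sphere {R} Z _.

Lemma Re_normc (R : realType) (a : R[i]) : (complex.Re `|a|)%:C = `|a|.
Proof. by rewrite normc_def. Qed.

Section rnorm_theory.
Context (R : realType) (Z : normedModType R[i]).
Implicit Types z : Z.

Lemma rnormE z : (rnorm z)%:C = `|z|.
Proof.
have := normr_ge0 z; rewrite /rnorm; move: `|z| => [a b].
by rewrite lecE /= => /andP[/eqP -> _].
Qed.

Lemma rnorm_ge0 z : 0 <= rnorm z.
Proof. by rewrite -lecR rnormE; exact: normr_ge0. Qed.

Lemma rnorm0 : rnorm (0 : Z) = 0.
Proof. by rewrite /rnorm normr0. Qed.

Lemma rnormD z1 z2 : rnorm (z1 + z2) <= rnorm z1 + rnorm z2.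
Proof. by rewrite -lecR rmorphD /= !rnormE ler_normD. Qed.

Lemma rnormZ (a : R[i]) z : rnorm (a *: z) = complex.Re `|a| * rnorm z.
Proof.
by apply: (@complexI R); rewrite rmorphM /= !rnormE normrZ Re_normc.
Qed.

Lemma rnorm_eq0 z : rnorm z = 0 -> z = 0.
Proof. by move=> z0; apply/normr0_eq0; rewrite -rnormE z0. Qed.

End rnorm_theory.

Section c0_space.
Context (R : realType) (X : normedModType R[i]).

Definition c0_pred : {pred nat -> X} :=
  mem [set x : nat -> X | x n @[n --> \oo] --> (0 : X)].

Record c0 := C0 { c0_seq :> nat -> X; _ : c0_seq \in c0_pred }.

HB.instance Definition _ := [isSub for c0_seq].
HB.instance Definition _ := [Choice of c0 by <:].

Lemma c0_submod_closed : submod_closed c0_pred.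
Proof.
split; first by rewrite inE; exact: cvg_cst.
move=> a x y /[!inE] x0 y0.
have -> : (0 : X) = a *: 0 + 0 by rewrite scaler0 addr0.
by apply: cvgD => //; exact: cvgZl_tmp.
Qed.

HB.instance Definition _ :=
  GRing.isSubmodClosed.Build _ _ c0_pred c0_submod_closed.
HB.instance Definition _ := [SubChoice_isSubLmodule of c0 by <:].

Lemma c0_cvg (x : c0) : x n @[n --> \oo] --> (0 : X).
Proof. by have := valP x; rewrite inE. Qed.

Definition c0_norm (x : c0) : R[i] := (sup [set rnorm (x n) | n in [set: nat]])%:C.

Lemma c0_has_sup (x : c0) : has_sup [set rnorm (x n) | n in [set: nat]].
Proof.
split; first by exists (rnorm (x 0%N)), 0%N.
have /cvgrPdist_le /(_ 1 ltr01) [N _ hN] := c0_cvg x.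
exists (1 + \sum_(i < N) rnorm (x i)) => _ [n _ <-].
have [nN|Nn] := ltnP n N.
  rewrite (bigD1 (Ordinal nN)) //= addrCA lerDl addr_ge0 // sumr_ge0 // => i _.
  exact: rnorm_ge0.
have := hN n Nn; rewrite /= sub0r normrN -rnormE.
rewrite (_ : 1 = 1%:C) // lecR => /le_trans -> //.
by rewrite lerDl sumr_ge0 // => i _; exact: rnorm_ge0.
Qed.

Lemma rnorm_le_c0_norm (x : c0) n : (rnorm (x n))%:C <= c0_norm x.
Proof. by rewrite lecR; apply: sup_upper_bound; [exact: c0_has_sup|exists n]. Qed.

Lemma c0_norm_le (x : c0) (M : R) :
  (forall n, rnorm (x n) <= M) -> c0_norm x <= M%:C.
Proof.
move=> xM; rewrite lecR; apply: ge_sup; first by case: (c0_has_sup x).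
by move=> _ [n _ <-].
Qed.

Lemma ler_c0_normD (x y : c0) : c0_norm (x + y) <= c0_norm x + c0_norm y.
Proof.
rewrite /c0_norm -rmorphD; apply: c0_norm_le => n.
apply: le_trans (rnormD _ _) _.
by apply: lerD; rewrite -lecR; exact: rnorm_le_c0_norm.
Qed.

Lemma c0_norm_ge0 (x : c0) : 0 <= c0_norm x.
Proof.
by apply: le_trans (rnorm_le_c0_norm x 0%N); rewrite rnormE; exact: normr_ge0.
Qed.

Lemma c0_normZ (a : R[i]) (x : c0) : c0_norm (a *: x) = `|a| * c0_norm x.
Proof.
have le_normZ b z : c0_norm (b *: z) <= `|b| * c0_norm z.
  rewrite -Re_normc /c0_norm -rmorphM; apply: c0_norm_le => n.
  rewrite [X in rnorm X](_ : _ = b *: z n) // rnormZ.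
  apply: ler_wpM2l; first by rewrite -lecR Re_normc; exact: normr_ge0.
  by rewrite -lecR; exact: rnorm_le_c0_norm.
apply/eqP; rewrite eq_le le_normZ /=.
have [->|a0] := eqVneq a 0; first by rewrite normr0 mul0r c0_norm_ge0.
rewrite -ler_pdivlMl ?normr_gt0 // -{1}(scale1r x) -(mulVf a0) -scalerA.
by rewrite -normfV; exact: le_normZ.
Qed.

Lemma c0_norm0_eq0 (x : c0) : c0_norm x = 0 -> x = 0.
Proof.
move=> x0; apply/val_inj/funext => n; apply: rnorm_eq0; apply/eqP.
by have := rnorm_le_c0_norm x n; rewrite x0 (lecR _ 0) eq_le rnorm_ge0 andbT.
Qed.

HB.instance Definition _ :=
  Lmodule_isNormed.Build R[i] c0 ler_c0_normD c0_normZ c0_norm0_eq0.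

End c0_space.

Section bounded_operators.
Context (R : realType) (Z Y : normedModType R[i]).

Definition bounded_op_pred : {pred Z -> Y} :=
  mem [set f : Z -> Y | linear f /\
    exists M : R, forall z, rnorm (f z) <= M * rnorm z].

Record bounded_op := BoundedOp {
  bounded_op_fun :> Z -> Y; _ : bounded_op_fun \in bounded_op_pred }.

HB.instance Definition _ := [isSub for bounded_op_fun].
HB.instance Definition _ := [Choice of bounded_op by <:].

Lemma bounded_op_submod_closed : submod_closed bounded_op_pred.
Proof.
split.
  rewrite inE; split; first by move=> a u v; rewrite /= scaler0 addr0.
  by exists 0 => z; rewrite mul0r rnorm0.
move=> a f g /[!inE] -[fl [M fM]] [gl [N gN]]; split.
  move=> b u v; rewrite !fctE fl gl !scalerDr !scalerA (mulrC a).
  by rewrite -!addrA; congr (_ + _); rewrite addrCA.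
exists (complex.Re `|a| * M + N) => z.
apply: le_trans (rnormD _ _) _; rewrite rnormZ mulrDl lerD // -mulrA.
by apply: ler_wpM2l => //; rewrite -lecR Re_normc; exact: normr_ge0.
Qed.

HB.instance Definition _ :=
  GRing.isSubmodClosed.Build _ _ bounded_op_pred bounded_op_submod_closed.
HB.instance Definition _ := [SubChoice_isSubLmodule of bounded_op by <:].

Lemma bounded_op_linear (T : bounded_op) : linear T.
Proof. by have := valP T; rewrite inE => -[]. Qed.

HB.instance Definition _ (T : bounded_op) :=
  GRing.isLinear.Build R[i] Z Y _ T (bounded_op_linear T).

Definition op_norm (T : bounded_op) : R[i] :=
  (sup [set rnorm (T z) | z in unit_ball Z])%:C.

Lemma op_norm_has_sup (T : bounded_op) :
  has_sup [set rnorm (T z) | z in unit_ball Z].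
Proof.
split; first by exists (rnorm (T 0)), 0; rewrite // /unit_ball /= normr0.
have := valP T; rewrite inE => -[_ [M TM]]; exists `|M| => _ [z z1 <-].
apply: le_trans (TM z) _; apply: le_trans (ler_wpM2r (rnorm_ge0 _) (ler_norm M)) _.
by rewrite ler_piMr // -lecR rnormE.
Qed.

Lemma op_norm_ge0 (T : bounded_op) : 0 <= op_norm T.
Proof.
rewrite lecR; apply: le_trans (rnorm_ge0 (T 0)) _.
apply: sup_upper_bound; first exact: op_norm_has_sup.
by exists 0; rewrite // /unit_ball /= normr0.
Qed.

Lemma op_norm_le (T : bounded_op) (M : R) :
  (forall z, `|z| <= 1 -> rnorm (T z) <= M) -> op_norm T <= M%:C.
Proof.
move=> TM; rewrite lecR; apply: ge_sup; first by case: (op_norm_has_sup T).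
by move=> _ [z z1 <-]; exact: TM.
Qed.

Lemma rnorm_le_op_norm (T : bounded_op) (z : Z) :
  `|z| <= 1 -> (rnorm (T z))%:C <= op_norm T.
Proof.
by move=> z1; rewrite lecR; apply: sup_upper_bound;
  [exact: op_norm_has_sup|exists z].
Qed.

Lemma norm_le_op_norm (T : bounded_op) (z : Z) : `|T z| <= op_norm T * `|z|.
Proof.
have [->|z0] := eqVneq z 0; first by rewrite linear0 !normr0 mulr0.
have z_gt0 : 0 < `|z| by rewrite normr_gt0.
rewrite -ler_pdivrMr // mulrC.
have := @rnorm_le_op_norm T (`|z|^-1 *: z).
rewrite rnormE linearZ /= !normrZ normfV normr_id mulVf ?gt_eqF //.
exact.
Qed.

Lemma ler_op_normD (S T : bounded_op) :
  op_norm (S + T) <= op_norm S + op_norm T.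
Proof.
rewrite /op_norm -rmorphD; apply: op_norm_le => z z1.
apply: le_trans (rnormD _ _) _.
by apply: lerD; rewrite -lecR; exact: rnorm_le_op_norm.
Qed.

Lemma op_normZ (a : R[i]) (T : bounded_op) : op_norm (a *: T) = `|a| * op_norm T.
Proof.
have le_normZ b U : op_norm (b *: U) <= `|b| * op_norm U.
  rewrite -Re_normc /op_norm -rmorphM; apply: op_norm_le => z z1.
  rewrite [X in rnorm X](_ : _ = b *: U z) // rnormZ.
  apply: ler_wpM2l; first by rewrite -lecR Re_normc; exact: normr_ge0.
  by rewrite -lecR; exact: rnorm_le_op_norm.
apply/eqP; rewrite eq_le le_normZ /=.
have [->|a0] := eqVneq a 0; first by rewrite normr0 mul0r op_norm_ge0.
rewrite -ler_pdivlMl ?normr_gt0 // -{1}(scale1r T) -(mulVf a0) -scalerA.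
by rewrite -normfV; exact: le_normZ.
Qed.

Lemma op_norm0_eq0 (T : bounded_op) : op_norm T = 0 -> T = 0.
Proof.
move=> T0; apply/val_inj/funext => z; apply: normr0_eq0.
apply/eqP; rewrite eq_le normr_ge0 andbT.
by have := norm_le_op_norm T z; rewrite T0 mul0r.
Qed.

HB.instance Definition _ :=
  Lmodule_isNormed.Build R[i] bounded_op ler_op_normD op_normZ op_norm0_eq0.

End bounded_operators.

Definition uniformly_convex (R : realType) (X : normedModType R[i]) :=
  forall e : R, 0 < e -> exists2 d : R, 0 < d &
    forall x y : X, unit_ball X x -> unit_ball X y -> e%:C <= `|x - y| ->
      d%:C <= 1 - `|2^-1 *: (x + y)|.

Definition unit_circle (R : realType) : set R[i] := [set l | `|l| = 1].
Arguments unit_circle R _ : clear implicits.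

(* The infimum is taken in the extended reals, so that it is +oo (rather than
   0) when Y is the trivial space, whose unit sphere is empty. *)
Definition C_convexity_modulus (R : realType) (Y : normedModType R[i])
    (e : R) : \bar R :=
  ereal_inf
    [set (ereal_sup [set (rnorm (x + (l * e%:C) *: y)%R)%:E
                    | l in unit_circle R] - 1)%E
    | x in unit_sphere Y & y in unit_sphere Y].

Definition C_uniformly_convex (R : realType) (Y : normedModType R[i]) :=
  forall e : R, 0 < e -> (0 < C_convexity_modulus Y e)%E.

Definition BPB_property (R : realType) (Z Y : normedModType R[i]) :=
  forall e : R, 0 < e -> exists2 eta : R, 0 < eta &
    forall (T : bounded_op Z Y) (x0 : Z),
      unit_sphere (bounded_op Z Y) T -> unit_sphere Z x0 -> 1 - eta%:C < `|T x0| ->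
      exists (S : bounded_op Z Y) (z0 : Z),
        [/\ unit_sphere (bounded_op Z Y) S, unit_sphere Z z0, `|S z0| = 1,
            `|S - T| < e%:C & `|z0 - x0| < e%:C].

(* Main.v *)
(* Uniform convexity of X only controls one coordinate at a time, while the
   C-convexity of Y shows that T is small on the coordinates where a near
   maximizer u of T has norm well below 1: T u + l T y stays in the unit ball
   for all |l| <= 1 whenever y is small and lives on these coordinates.

   Let |T x| be almost 1, let f be a functional norming T x, and perturb T to
   S = T + rho (f o T) (.) T x. A near maximizer x2 of S has f (T x2) almost 1
   after a rotation, so u = (x + x2) / 2 is still a near maximizer of T. On the
   set A of coordinates where |u(i)| > 1 - b, uniform convexity of X gives that
   x2(i) is close to x(i); outside A both T and S are small, so there x2 may be
   replaced by x at the cost of a small change of S that turns the new point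
   into an equally good near maximizer. This yields a pair (T', x') close to
   (T, x) with |T' x'| as close to 1 as desired, and iterating with
   geometrically decreasing errors gives the norm attaining pair in the limit. *)

Require Import Defs.
From HB Require Import structures.
From mathcomp Require Import all_boot all_order all_algebra.
From mathcomp Require Import complex.
From mathcomp Require Import all_classical all_reals all_analysis.
From mathcomp Require Import ring lra.

Set Implicit Arguments.
Unset Strict Implicit.
Unset Printing Implicit Defensive.

Import Order.TTheory GRing.Theory Num.Theory.
Import numFieldNormedType.Exports.

Local Open Scope classical_set_scope.
Local Open Scope ring_scope.
Local Open Scope complex_scope.

(** * Norming functionals *)

Section hahn_banach.
Context (R : realType) (V : lmodType R[i]).
Implicit Types (p q : V -> R) (x y : V) (a t : R).

Definition sublinear q :=
  (forall x y, q (x + y) <= q x + q y) /\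
  (forall a x, 0 < a -> q (a%:C *: x) <= a * q x).

Lemma sublinear0 q : sublinear q -> q 0 = 0.
Proof.
move=> [_ qZ]; have := qZ 2 0 ltac:(lra); have := qZ 2^-1 0 ltac:(lra).
by rewrite !scaler0; lra.
Qed.

Lemma sublinearZ q a x : sublinear q -> 0 <= a -> q (a%:C *: x) = a * q x.
Proof.
move=> sq; rewrite le_eqVlt => /predU1P[<-|a0].
  by rewrite scale0r mul0r sublinear0.
apply/eqP; rewrite eq_le sq.2 //= -ler_pdivlMl //.
have := sq.2 a^-1 (a%:C *: x); rewrite invr_gt0 => /(_ a0).
by rewrite scalerA -rmorphM mulVf ?gt_eqF // scale1r.
Qed.

Lemma sublinear_lbound q x : sublinear q -> - q (- x) <= q x.
Proof.
by move=> sq; have := sq.1 x (- x); rewrite subrr sublinear0 //; lra.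
Qed.

(** Every member is at least [- p (- x)] at [x], so the infima are finite. Subadditivity uses
    comparability: of a member chosen for [x] and one chosen for [y], the smaller serves both
    points. *)
Lemma sublinear_inf_chain p (F : set (V -> R)) : F !=set0 ->
  (forall q, F q -> sublinear q /\ forall x, q x <= p x) ->
  (forall q q', F q -> F q' -> (forall x, q x <= q' x) \/ (forall x, q' x <= q x)) ->
  let m x := inf [set q x | q in F] in
  sublinear m /\ (forall q, F q -> forall x, m x <= q x).
Proof.
move=> [q0 Fq0] Fs Ft m.
have ne x : [set q x | q in F] !=set0 by exists (q0 x), q0.
have mle q : F q -> forall x, m x <= q x.
  move=> Fq x; apply: ge_inf; last by exists q.
  exists (- p (- x)) => _ [r Fr <-]; have [sr rp] := Fs _ Fr.
  by apply: le_trans (sublinear_lbound x sr); rewrite lerN2.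
split=> //; split=> [x y|a x a0].
  rewrite -lerBlDl; apply: lb_le_inf => // _ [s Fs' <-].
  rewrite lerBlDl -lerBlDr; apply: lb_le_inf => // _ [t Ft' <-].
  rewrite lerBlDr; have [st|ts] := Ft _ _ Fs' Ft'.
    apply: le_trans (mle _ Fs' _) _; apply: le_trans ((Fs _ Fs').1.1 _ _) _.
    by rewrite lerD2r.
  apply: le_trans (mle _ Ft' _) _; apply: le_trans ((Fs _ Ft').1.1 _ _) _.
  by rewrite lerD2l.
rewrite -ler_pdivrMl //; apply: lb_le_inf => // _ [s Fs' <-].
rewrite ler_pdivrMl //; apply: le_trans (mle _ Fs' _) _.
exact: (Fs _ Fs').1.2.
Qed.

(* The witness is [r x = inf_(t >= 0) (q (x + t y) - t q y)]. Applied to a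
   minimal sublinear functional, it shows that the latter is odd, hence additive. *)
Lemma sublinear_decrease q y : sublinear q ->
  exists r, [/\ sublinear r, forall x, r x <= q x & r (- y) <= - q y].
Proof.
move=> sq; pose E x := [set q (x + t%:C *: y) - t * q y | t in [set t | 0 <= t]].
have ne x : E x !=set0 by exists (q (x + 0%:C *: y) - 0 * q y), 0; rewrite /=.
have rle x t : 0 <= t -> inf (E x) <= q (x + t%:C *: y) - t * q y.
  move=> t0; apply: ge_inf; last by exists t.
  exists (- q (- x)) => _ [s s0 <-]; rewrite -(sublinearZ _ sq) //.
  have := sq.1 (x + s%:C *: y) (- x); rewrite addrAC subrr add0r; lra.
exists (fun x => inf (E x)); split; first split.
- move=> x x'; rewrite -lerBlDl; apply: lb_le_inf => // _ [s s0 <-].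
  rewrite lerBlDl -lerBlDr; apply: lb_le_inf => // _ [t t0 <-].
  have := rle (x + x') (s + t) (addr_ge0 s0 t0).
  have := sq.1 (x + t%:C *: y) (x' + s%:C *: y).
  rewrite addrACA -scalerDl -rmorphD (addrC t s); lra.
- move=> a x a0; rewrite -ler_pdivrMl //; apply: lb_le_inf => // _ [t t0 <-].
  rewrite ler_pdivrMl // mulrBr -(sublinearZ _ sq); last exact: ltW.
  rewrite scalerDr scalerA -rmorphM mulrA; apply: rle.
  by apply: mulr_ge0 => //; exact: ltW.
- by move=> x; have := rle x 0 (lexx _); rewrite scale0r addr0 mul0r subr0.
- have := rle (- y) 1 ler01.
  by rewrite scale1r addNr sublinear0 // mul1r sub0r.
Qed.

(** Zorn's lemma for the reversed pointwise order: nonempty chains are bounded by their pointwise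
    infimum, the empty one by [p]. *)
Lemma exists_minimal_sublinear p : sublinear p ->
  exists q, [/\ sublinear q, forall x, q x <= p x &
    forall r, sublinear r -> (forall x, r x <= q x) -> r = q].
Proof.
move=> sp; pose P q := sublinear q /\ forall x, q x <= p x.
pose T := {q | P q}; pose L (s t : T) := `[< forall x, sval t x <= sval s x >].
have [||||[q [sq qp]] qmin] := @Zorn T L.
- by move=> s; apply/asboolP.
- move=> r s t /asboolP rs /asboolP st; apply/asboolP => x.
  exact: le_trans (st x) (rs x).
- move=> [s Ps] [t Pt] /asboolP /= st /asboolP /= ts.
  apply: eq_exist => /=; apply/funext => x.
  by apply/eqP; rewrite eq_le ts st.
- move=> A totA; have [A0|] := pselect (A = set0).
    by exists (exist P p (conj sp (fun x => lexx _))) => s; rewrite A0.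
  move=> /eqP/set0P A0; pose F := [set sval s | s in A].
  have [||| sm mle] := @sublinear_inf_chain p F.
  + by case: A0 => s As; exists (sval s), s.
  + by move=> _ [[s [ss sp']] As <-].
  + move=> _ _ [s As <-] [t At <-].
    by have [/asboolP|/asboolP] := totA _ _ As At; [right|left].
  have Pm : P (fun x => inf [set q x | q in F]).
    split=> // x; case: A0 => s As.
    apply: le_trans (mle (sval s) _ x) _; first by exists s.
    by case: s As => s [/= ].
  by exists (exist P _ Pm) => s As; apply/asboolP => /= x; apply: mle; exists s.
exists q; split=> // r sr rq.
have Pr : P r by split=> // x; apply: le_trans (rq x) (qp x).
have := qmin (exist P r Pr); rewrite /L /= => H.
have [] // : exist P r Pr = exist P q (conj sq qp).
by apply: H; apply/asboolP.
Qed.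

(** Lowering [p] first to [p'] with [p' (- v) <= - p v] forces [f v = p v] for every odd [f] below
    [p']. A minimal functional below [p'] is odd, hence real linear. *)
Lemma hahn_banach_real p v : sublinear p ->
  exists f : V -> R, [/\ forall x y, f (x + y) = f x + f y,
    forall a x, f (a%:C *: x) = a * f x, forall x, f x <= p x & f v = p v].
Proof.
move=> sp; have [p' [sp' p'p p'v]] := sublinear_decrease v sp.
have [f [sf fp' fmin]] := exists_minimal_sublinear sp'.
have fN y : f (- y) = - f y.
  have [r [sr rf ry]] := sublinear_decrease y sf.
  rewrite (fmin _ sr rf) in ry; have := sublinear_lbound (- y) sf.
  by rewrite opprK; lra.
exists f; split.
- move=> x y; apply/eqP; rewrite eq_le sf.1 /=.
  have := sf.1 (- x) (- y); rewrite -opprD !fN; lra.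
- move=> a x; have [a0|a0] := leP 0 a; first exact: sublinearZ.
  have := sublinearZ x sf (_ : 0 <= - a); rewrite oppr_ge0 (ltW a0) => /(_ isT).
  by rewrite rmorphN scaleNr fN; lra.
- by move=> x; apply: le_trans (fp' x) (p'p x).
- apply/eqP; rewrite eq_le; have := fp' (- v); rewrite fN.
  by have := fp' v; have := p'p v; lra.
Qed.

End hahn_banach.

(** * Real-valued norms and complex norming functionals *)

Section real_norm.
Context (R : realType) (V : normedModType R[i]).
Implicit Types (u v w : V).

Lemma rnormN v : rnorm (- v) = rnorm v.
Proof. by rewrite /rnorm normrN. Qed.

Lemma rnorm_distC u v : rnorm (u - v) = rnorm (v - u).
Proof. by rewrite -rnormN opprB. Qed.

Lemma rnormB u v : rnorm u - rnorm v <= rnorm (u - v).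
Proof. by rewrite lerBlDr; have := rnormD (u - v) v; rewrite subrK. Qed.

Lemma rnormZr (a : R) v : 0 <= a -> rnorm (a%:C *: v) = a * rnorm v.
Proof. by move=> a0; rewrite rnormZ ger0_norm // lecR. Qed.

Lemma rnormZ1 (a : R[i]) v : `|a| = 1 -> rnorm (a *: v) = rnorm v.
Proof. by move=> a1; rewrite rnormZ a1 mul1r. Qed.

Lemma norm_le1 v : (`|v| <= 1) = (rnorm v <= 1).
Proof. by rewrite -rnormE (lecR _ 1). Qed.

Lemma norm_eq1 v : (`|v| = 1) <-> (rnorm v = 1).
Proof. by rewrite -rnormE; split=> [/complexI|->]. Qed.

Lemma rnorm_gt0 v : v != 0 -> 0 < rnorm v.
Proof.
by move=> v0; rewrite lt_neqAle rnorm_ge0 andbT eq_sym; apply: contra_neq v0 => /rnorm_eq0.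
Qed.

(** Complexification of a real functional g dominated by the norm: f(z) = g(z) - i g(iz). *)
Lemma norming_functional v : exists f : V -> R[i],
  [/\ forall a x y, f (a *: x + y) = a * f x + f y,
      forall x, `|f x| <= `|x| & f v = `|v|].
Proof.
have sn : sublinear (@rnorm R V).
  by split=> [|a x a0]; [exact: rnormD|rewrite rnormZr // ltW].
have [g [gD gZ gn gv]] := hahn_banach_real v sn.
pose f z := g z +i* (- g ('i *: z)).
have fD x y : f (x + y) = f x + f y.
  by rewrite /f scalerDr !gD opprD; apply/eqP; rewrite eq_complex /= !eqxx.
have gN x : g (- x) = - g x.
  by have := gZ (-1) x; rewrite rmorphN1 scaleN1r mulN1r.
have fZ a x : f (a *: x) = a * f x.
  case: a => b c; have -> : (b +i* c)%C *: x = b%:C *: x + c%:C *: ('i *: x).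
    rewrite scalerA -scalerDl; congr (_ *: _).
    by apply/eqP; rewrite eq_complex /=; apply/andP; split; apply/eqP; ring.
  rewrite /f scalerDr !scalerA !(mulrC 'i) -!scalerA !gD !gZ scalerA.
  have -> : 'i * 'i = -1 :> R[i].
    by apply/eqP; rewrite eq_complex /=; apply/andP; split; apply/eqP; ring.
  rewrite scaleN1r gN; apply/eqP; rewrite eq_complex /=.
  by apply/andP; split; apply/eqP; ring.
(* A rotation of [x] makes [f x] real and nonnegative, and there it equals [g]. *)
have fn x : `|f x| <= `|x|.
  have [->|fx0] := eqVneq (f x) 0; first by rewrite normr0.
  have a1 : `| `|f x| / f x | = 1.
    by rewrite normrM normfV normr_id divff // normr_eq0.
  have := gn ((`|f x| / f x) *: x); rewrite rnormZ1 // -lecR rnormE.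
  apply: le_trans; rewrite -(Re_normc (f x)) lecR.
  have := fZ (`|f x| / f x) x; rewrite divfK // => H.
  by rewrite -[g _]/(complex.Re (f _)) H.
exists f; split=> //; first by move=> a x y; rewrite fD fZ.
(* The real part of [f v] is already the norm of [v], which leaves no room for an imaginary part. *)
have := fn v; rewrite /f gv normc_def -rnormE lecR.
set c := (- _) => /=; move=> H.
have c0 : c = 0.
  have : Num.sqrt (rnorm v ^+ 2 + c ^+ 2) ^+ 2 <= rnorm v ^+ 2.
    by rewrite ler_pXn2r // nnegrE ?sqrtr_ge0 ?rnorm_ge0.
  rewrite sqr_sqrtr ?addr_ge0 ?sqr_ge0 // gerDl => c2.
  by apply/eqP; rewrite -sqrf_eq0 eq_le c2 sqr_ge0.
by rewrite c0.
Qed.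

End real_norm.

(** * Norm estimates for operators and null sequences *)

Section bounded_op_norm.
Context (R : realType) (Z Y : normedModType R[i]).
Implicit Types T : bounded_op Z Y.

Lemma rnorm_op_le T (M : R) :
  (forall z, rnorm z <= 1 -> rnorm (T z) <= M) -> rnorm T <= M.
Proof. by move=> TM; rewrite -lecR; apply: op_norm_le => z; rewrite norm_le1; exact: TM. Qed.

Lemma rnorm_op_bound T z : rnorm (T z) <= rnorm T * rnorm z.
Proof. by have := norm_le_op_norm T z; rewrite -!rnormE -rmorphM lecR. Qed.

Lemma rnorm_op_ball T z : rnorm z <= 1 -> rnorm (T z) <= rnorm T.
Proof.
by move=> z1; apply: le_trans (rnorm_op_bound T z) _; rewrite ler_piMr ?rnorm_ge0.
Qed.

Lemma rnorm_op_adherent T (e : R) : 0 < e ->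
  exists2 z, rnorm z <= 1 & rnorm T - e < rnorm (T z).
Proof.
move=> e0; have [_ [z z1 <-] H] := sup_adherent e0 (op_norm_has_sup T).
by exists z; rewrite -?norm_le1.
Qed.

Lemma exists_bounded_op (f : Z -> Y) (M : R) : linear f ->
  (forall z, rnorm (f z) <= M * rnorm z) -> exists T : bounded_op Z Y, T =1 f.
Proof.
move=> fl fM; have fP : f \in @bounded_op_pred R Z Y by rewrite inE; split=> //; exists M.
by exists (BoundedOp fP).
Qed.

End bounded_op_norm.

Section c0_norm.
Context (R : realType) (X : normedModType R[i]).
Implicit Types x : c0 X.

Lemma rnorm_c0_coord x n : rnorm (x n) <= rnorm x.
Proof. by have := rnorm_le_c0_norm x n; rewrite lecR. Qed.

Lemma rnorm_c0_le x (M : R) : (forall n, rnorm (x n) <= M) -> rnorm x <= M.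
Proof. by move=> xM; have := c0_norm_le xM; rewrite lecR. Qed.

End c0_norm.

(** If [w] were longer than [e], normalizing [u] and [w] and applying the modulus would give a point
    of norm above [1 + d / 2]. That point is some [u + m *: w] with [|m| <= 1], divided by the norm
    of [u], so its norm is at most [1 / (1 - d / 4)], which is too small. *)
Lemma C_uniformly_convex_small (R : realType) (Y : normedModType R[i]) (e : R) :
  C_uniformly_convex Y -> 0 < e -> exists2 k : R, 0 < k <= 4^-1 &
    forall u w : Y, (forall m : R[i], `|m| <= 1 -> rnorm (u + m *: w) <= 1) ->
      1 - k <= rnorm u -> rnorm w <= e.
Proof.
move=> cY e0; have := cY e e0; rewrite /C_convexity_modulus.
set m := ereal_inf _ => m0.
(* The modulus may be [+oo], so a real lower bound capped at 1 replaces it. *)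
have [d /andP[d0 d1] dm] : exists2 d : R, 0 < d <= 1 & (d%:E <= m)%E.
  case: m m0 => [r| |] //; rewrite ?lte_fin => r0.
    exists (Num.min r 1); last by rewrite lee_fin ge_min lexx.
    by rewrite lt_min r0 ltr01 ge_min lexx orbT.
  by exists 1; rewrite ?ltr01 ?lexx ?leey.
exists (d / 4); first by apply/andP; split; lra.
move=> u w uw ku; rewrite leNgt; apply/negP => ew.
have u0 : 0 < rnorm u by lra.
have w0 : 0 < rnorm w by lra.
have u1 : rnorm u <= 1 by have := uw 0; rewrite scale0r addr0; apply; rewrite normr0.
pose x := (rnorm u)^-1%:C *: u; pose y := (rnorm w)^-1%:C *: w.
have x1 : unit_sphere Y x.
  by apply/norm_eq1; rewrite rnormZr ?invr_ge0 ?(ltW u0) // mulVf ?gt_eqF.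
have y1 : unit_sphere Y y.
  by apply/norm_eq1; rewrite rnormZr ?invr_ge0 ?(ltW w0) // mulVf ?gt_eqF.
have : (d%:E <= ereal_sup [set (rnorm (x + (l * e%:C) *: y)%R)%:E
                    | l in unit_circle R] - 1)%E.
  by apply: le_trans dm _; apply: ereal_inf_lbound; exists x => //; exists y.
set s := ereal_sup _ => ds.
have : ((1 + d / 2)%:E < s)%E.
  case: s ds => [r| |] //; last by rewrite ltry.
  by rewrite -EFinB lee_fin lte_fin; lra.
move=> /ereal_sup_gt[_ [l l1 <-]]; rewrite lte_fin.
have -> : x + (l * e%:C) *: y =
    (rnorm u)^-1%:C *: (u + (l * (e * rnorm u / rnorm w)%:C) *: w).
  rewrite /x /y scalerDr !scalerA; congr (_ + _ *: _).
  rewrite -mulrA (mulrCA _^-1%:C) -!rmorphM; congr (_ * _%:C).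
  by field; rewrite !gt_eqF.
rewrite rnormZr ?invr_ge0 ?(ltW u0) // ltr_pdivlMl //.
have := uw (l * (e * rnorm u / rnorm w)%:C).
have s0 : 0 <= e * rnorm u / rnorm w by rewrite divr_ge0 ?mulr_ge0 // ltW.
rewrite normrM l1 mul1r ger0_norm ?(lecR 0) // (lecR _ 1) ler_pdivrMr // mul1r.
move=> H; have : e * rnorm u <= rnorm w by nra.
move=> /H; nra.
Qed.

(** * Near maximizers on c_0(X) *)

Section c0_mix.
Context (R : realType) (X : normedModType R[i]).
Implicit Types (A : pred nat) (z w : c0 X).

Lemma c0_mix_subproof A z w :
  (fun n => if A n then z n else w n) \in @c0_pred R X.
Proof.
rewrite inE; apply/cvgrPdist_le => e e0.
have /cvgrPdist_le /(_ e e0) z0 := c0_cvg z.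
have /cvgrPdist_le /(_ e e0) w0 := c0_cvg w.
by near=> n; case: ifP => _; near: n.
Unshelve. all: by end_near. Qed.

Definition c0_mix A z w : c0 X := C0 (c0_mix_subproof A z w).

Lemma c0_mixE A z w n : c0_mix A z w n = if A n then z n else w n.
Proof. by []. Qed.

Lemma c0_eqP z w : (forall n, z n = w n) -> z = w.
Proof. by move=> zw; apply/val_inj/funext. Qed.

Lemma c0_coord_linear a z w n : (a *: z + w) n = a *: z n + w n.
Proof. by []. Qed.

Lemma c0_mix_linear A a z w z' w' :
  c0_mix A (a *: z + z') (a *: w + w') = a *: c0_mix A z w + c0_mix A z' w'.
Proof.
by apply: c0_eqP => n; rewrite c0_mixE !c0_coord_linear !c0_mixE; case: ifP.
Qed.

Lemma rnorm_c0_mix A z w (M : R) :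
  rnorm z <= M -> rnorm w <= M -> rnorm (c0_mix A z w) <= M.
Proof.
move=> zM wM; apply: rnorm_c0_le => n; rewrite c0_mixE.
by case: ifP => _; apply: le_trans (rnorm_c0_coord _ _) _.
Qed.

End c0_mix.

(** * Perturbing operators and their near maximizers *)

Section near_maximizers.
Context (R : realType).

(** At [x] the perturbed operator has norm [(1 + rho * n) * n], with [n] the norm of [T x]. A near
    maximizer can compete only if [f] is almost 1 in modulus at its image; after a rotation, [f] at
    the image of the midpoint is a mean of two numbers near 1. *)
Lemma rank_one_perturbation (Z Y : normedModType R[i]) (T : bounded_op Z Y)
    (x : Z) (eta rho h : R) :
  0 < eta <= 1 -> 0 < rho <= 1 -> 0 < h ->
  rnorm T = 1 -> rnorm x <= 1 -> 1 - eta < rnorm (T x) ->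
  exists (S : bounded_op Z Y) (x2 : Z),
    [/\ rnorm (S - T) <= rho, forall z, rnorm (S z) <= 2 * rnorm (T z),
      rnorm x2 <= 1, rnorm S - h < rnorm (S x2)
      & 1 - 5 * eta / rho <= rnorm (T (2^-1%:C *: (x + x2)))].
Proof.
move=> /andP[eta0 eta1] /andP[rho0 rho1] h0 T1 x1 Tx.
have [f [fl fn fx]] := norming_functional (T x).
pose c z := complex.Re `|f (T z)|.
have cE z : (c z)%:C = `|f (T z)| by exact: Re_normc.
have c0 z : 0 <= c z by rewrite -lecR cE (normr_ge0 (f (T z))).
have cT z : c z <= rnorm (T z) by rewrite -lecR cE rnormE.
have Tx1 : rnorm (T x) <= 1 by rewrite -T1; exact: rnorm_op_ball.
pose n := rnorm (T x).
pose F z := T z + (rho%:C * f (T z)) *: T x.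
have Fl : linear F.
  move=> a z w; rewrite /F linearP fl mulrDr scalerDl !scalerDr !scalerA.
  by rewrite (mulrCA rho%:C a) addrACA.
have F2 z : rnorm ((rho%:C * f (T z)) *: T x) = rho * c z * n.
  by rewrite -scalerA rnormZr ?ltW // rnormZ mulrA.
have Fle z : rnorm (F z) <= rnorm (T z) + rho * c z.
  apply: le_trans (rnormD _ _) _; rewrite lerD2l F2 ler_piMr //.
  by rewrite mulr_ge0 // ltW.
have F2T z : rnorm (F z) <= 2 * rnorm (T z).
  by apply: le_trans (Fle z) _; have := cT z; have := c0 z; nra.
have [|S SF] := @exists_bounded_op _ _ _ F 2 Fl.
  move=> z; apply: le_trans (F2T z) _; rewrite ler_pM2l //.
  by have := rnorm_op_bound T z; rewrite T1 mul1r.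
(* Precision [h] is the one demanded; [eta] is the one used to bound [c y] from below. *)
have [|y y1 Sy] := @rnorm_op_adherent _ _ _ S (Num.min h eta).
  by rewrite lt_min h0.
have Sx : rnorm (S x) = (1 + rho * n) * n.
  rewrite SF /F fx -rnormE -rmorphM -{1}(scale1r (T x)) -scalerDl -(rmorphD (real_complex R) 1).
  by rewrite rnormZr // addr_ge0 // mulr_ge0 ?rnorm_ge0 // ltW.
(* The unimodular factor that makes [f (T (a *: y))] equal to [c y]; when [f (T y)] vanishes any
   such factor works, and 1 is taken. *)
pose a := if f (T y) == 0 then 1 else `|f (T y)| / f (T y).
have a1 : `|a| = 1.
  rewrite /a; case: eqVneq => [|fy0]; first by rewrite normr1.
  by rewrite normrM normfV normr_id divff // normr_eq0.
have fZ b u : f (b *: u) = b * f u.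
  have f0 : f 0 = 0.
    by have := fl (-1) 0 0; rewrite scaler0 addr0 mulN1r => ->; rewrite addNr.
  by have := fl b u 0; rewrite !addr0 f0 addr0.
have afy : f (T (a *: y)) = (c y)%:C.
  rewrite linearZ /= fZ cE /a; case: eqVneq => [->|fy0].
    by rewrite normr0 mulr0.
  by rewrite divfK.
exists S, (a *: y); split.
- apply: rnorm_op_le => z z1.
  have -> : (S - T) z = (rho%:C * f (T z)) *: T x.
    by rewrite [LHS](_ : _ = S z - T z) // SF /F addrC addKr.
  rewrite F2 -mulrA ler_piMr ?(ltW rho0) // mulr_ile1 ?rnorm_ge0 //.
  by apply: le_trans (cT z) _; rewrite -T1; exact: rnorm_op_ball.
- by move=> z; rewrite SF.
- by rewrite rnormZ1.
- rewrite linearZ /= rnormZ1 //; apply: le_lt_trans Sy.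
  by rewrite lerB // ge_min lexx.
(* The four [eta] are one from [n], one from the precision of [y], and two from
   [n * n >= 1 - 2 * eta], using [rho <= 1]. *)
- have c1 : 1 - 4 * eta / rho <= c y.
    have H1 := rnorm_op_ball S x1; rewrite Sx in H1.
    have H2 : rnorm (S y) <= 1 + rho * c y.
      rewrite SF; apply: le_trans (Fle y) _; rewrite lerD2r -T1.
      exact: rnorm_op_ball.
    have H3 : Num.min h eta <= eta by rewrite ge_min lexx orbT.
    have : 1 + rho - 4 * eta <= 1 + rho * c y.
      have n1 : 1 - eta < n by [].
      have n2 : 2 * n - 1 <= n * n by have := sqr_ge0 (n - 1); rewrite expr2; lra.
      have n3 : rho * (2 * n - 1) <= rho * (n * n) by rewrite ler_pM2l.
      have n4 : rho * (1 - 2 * eta) <= rho * (2 * n - 1) by rewrite ler_pM2l //; lra.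
      have n5 : rho * eta <= eta by rewrite ler_piMl // ltW.
      lra.
    have E : rho * (4 * eta / rho) = 4 * eta by field; rewrite gt_eqF.
    by rewrite -[_ <= c y](ler_pM2l rho0) mulrBr E; lra.
  pose u := 2^-1%:C *: (x + a *: y).
  have fu : f (T u) = (2^-1 * (n + c y))%:C.
    rewrite /u linearZ /= linearD /= fZ -(scale1r (T x)) fl mul1r fx afy.
    by rewrite rmorphM rmorphD /= -/n -rnormE.
  have := cT u; rewrite /c fu normc_def /= expr0n addr0 sqrtr_sqr.
  apply: le_trans; rewrite ger0_norm; last first.
    by rewrite mulr_ge0 ?addr_ge0 ?rnorm_ge0.
  have H4 : eta <= eta / rho by rewrite ler_pdivlMr // ler_piMr // ltW.
  have : 1 - eta < n by [].
  by rewrite -!mulrA in c1 *; move: (eta / rho) H4 c1 => q; lra.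
Qed.

(** Adding [m * b] times [y] to [u] stays in the unit ball: where [y] is allowed to be nonzero, [u]
    has norm at most [1 - b]. Complex convexity, applied to [T u] and [b] times [T y] with bound
    [b * g], gives the claim. *)
Lemma C_uniformly_convex_off_support (X Y : normedModType R[i]) (b g : R) :
  C_uniformly_convex Y -> 0 < b <= 1 -> 0 < g ->
  exists2 k : R, 0 < k <= 4^-1 &
    forall (T : bounded_op (c0 X) Y) (u y : c0 X), rnorm T = 1 -> rnorm u <= 1 ->
      1 - k <= rnorm (T u) -> rnorm y <= 1 ->
      (forall n, 1 - b < rnorm (u n) -> y n = 0) -> rnorm (T y) <= g.
Proof.
move=> cY /andP[b0 b1] g0.
have [k k0 H] := C_uniformly_convex_small cY (mulr_gt0 b0 g0).
exists k => // T u y T1 u1 Tu y1 yA.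
rewrite -(ler_pM2l b0) -rnormZr ?(ltW b0) //; apply: H Tu => m m1.
rewrite scalerA addrC -linearP -T1; apply: rnorm_op_ball.
apply: rnorm_c0_le => n; rewrite c0_coord_linear.
have [un|un] := ltP (1 - b) (rnorm (u n)).
  rewrite yA // scaler0 add0r; exact: le_trans (rnorm_c0_coord u n) u1.
apply: le_trans (rnormD _ _) _.
suff : rnorm ((m * b%:C) *: y n) <= b by lra.
rewrite mulrC -scalerA rnormZr ?(ltW b0) // ler_piMr // ?(ltW b0) //.
rewrite rnormZ mulr_ile1 ?rnorm_ge0 //.
- by rewrite -lecR Re_normc (normr_ge0 m).
- by rewrite -lecR Re_normc.
- exact: le_trans (rnorm_c0_coord y n) y1.
Qed.

(** [x] is a convex combination of the two points whose coordinate [i] is plus or minus the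
    normalized [x i]. The plus point has weight at least 1/2, so its loss is at most twice that of
    [x]. *)
Lemma normalize_coord (X Y : normedModType R[i]) (S : bounded_op (c0 X) Y)
    (x : c0 X) (i : nat) (h : R) :
  rnorm x <= 1 -> 0 < rnorm (x i) -> rnorm S - h < rnorm (S x) -> 0 <= h ->
  exists x3 : c0 X, [/\ rnorm x3 <= 1, x3 i = (rnorm (x i))^-1%:C *: x i,
    forall n, n != i -> x3 n = x n & rnorm S - 2 * h < rnorm (S x3)].
Proof.
set t := rnorm (x i) => x1 t0 Sx h0.
have t1 : t <= 1 by exact: le_trans (rnorm_c0_coord x i) x1.
pose y (s : R) := c0_mix (pred1 i) ((s * t^-1)%:C *: x) x.
have y1 s : `|s| = 1 -> rnorm (y s) <= 1.
  move=> s1; apply: rnorm_c0_le => n; rewrite c0_mixE /=.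
  case: eqVneq => [->|_]; last exact: le_trans (rnorm_c0_coord x n) x1.
  rewrite [X in rnorm X](_ : _ = (s * t^-1)%:C *: x i) // rnormZ normc_def /=.
  rewrite expr0n addr0 sqrtr_sqr normrM s1 mul1r ger0_norm ?invr_ge0 ?(ltW t0) //.
  by rewrite mulVf // gt_eqF.
have xE : x = ((1 + t) / 2)%:C *: y 1 + ((1 - t) / 2)%:C *: y (-1).
  apply: c0_eqP => n; rewrite c0_coord_linear.
  rewrite [X in _ + X](_ : _ = ((1 - t) / 2)%:C *: y (-1) n) // !c0_mixE /=.
  case: eqVneq => [->|_]; last first.
    have tE : (1 + t) / 2 + (1 - t) / 2 = 1 by field.
    by rewrite -scalerDl -rmorphD tE scale1r.
  rewrite ![X in _ = _ *: X + _](_ : _ = (1 * t^-1)%:C *: x i) //.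
  rewrite ![X in _ = _ + _ *: X](_ : _ = (-1 * t^-1)%:C *: x i) //.
  have tE : (1 + t) / 2 * (1 * t^-1) + (1 - t) / 2 * (- 1 * t^-1) = 1.
    by field; rewrite gt_eqF.
  by rewrite !scalerA -!rmorphM -scalerDl -rmorphD tE scale1r.
exists (y 1); split; first by apply: y1; rewrite normr1.
- by rewrite c0_mixE /= eqxx mul1r.
- by move=> n ni; rewrite c0_mixE /= (negbTE ni).
have : rnorm (S x) <= (1 + t) / 2 * rnorm (S (y 1)) + (1 - t) / 2 * rnorm (S (y (-1))).
  rewrite {1}xE linearP linearZ /=; apply: le_trans (rnormD _ _) _.
  by rewrite !rnormZr //; lra.
have := rnorm_op_ball S (y1 (-1) ltac:(by rewrite normrN1)).
move: (rnorm (S (y 1))) (rnorm (S (y (-1)))) (rnorm S) (rnorm (S x)) Sx.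
by move=> p q r s; nra.
Qed.

(* [T'] is [S] precomposed with a contraction sending [c0_mix A x3 x] to [x3]:
   it keeps the coordinates in [A] and reads the others off the coordinate [i],
   so that being close to the norm is preserved exactly. *)
Lemma transfer_maximizer (X Y : normedModType R[i]) (S : bounded_op (c0 X) Y)
    (x x3 : c0 X) (A : pred nat) (i : nat) (g : R) :
  rnorm x3 <= 1 -> A i -> rnorm (x3 i) = 1 ->
  (forall y : c0 X, rnorm y <= 1 -> (forall n, A n -> y n = 0) -> rnorm (S y) <= g) ->
  exists T' : bounded_op (c0 X) Y,
    [/\ rnorm (T' - S) <= 2 * g, rnorm T' <= rnorm S &
        T' (c0_mix A x3 x) = S x3].
Proof.
move=> x31 Ai x3i Sg.
have [f [fl fn fx]] := norming_functional (x3 i).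
(* The contraction [W] sends [c0_mix A x3 x] to [x3], because this point has coordinate [x3 i] at
   [i], where [f] takes the value 1. *)
pose W (z : c0 X) := c0_mix A z (f (z i) *: x3).
have Wl : linear W.
  move=> a z w; rewrite /W -c0_mix_linear; congr c0_mix.
  by rewrite c0_coord_linear fl scalerDl scalerA.
have fz (z : c0 X) : rnorm z <= 1 -> rnorm (f (z i) *: x3) <= 1.
  move=> z1; rewrite rnormZ mulr_ile1 ?rnorm_ge0 //.
    by rewrite -lecR Re_normc (normr_ge0 (f _)).
  rewrite -lecR Re_normc; apply: le_trans (fn _) _.
  by rewrite -rnormE lecR; apply: le_trans (rnorm_c0_coord z i) z1.
have W1 z : rnorm z <= 1 -> rnorm (W z) <= 1.
  by move=> z1; apply: rnorm_c0_mix => //; exact: fz.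
have SWl : linear (S \o W) by move=> a z w; rewrite /= Wl linearP.
have WZ a z : W (a *: z) = a *: W z.
  have W0 : W 0 = 0.
    by have := Wl (-1) 0 0; rewrite scaler0 addr0 scaleN1r => ->; rewrite addNr.
  by have := Wl a z 0; rewrite !addr0 W0 addr0.
have [|T' T'E] := @exists_bounded_op _ _ _ (S \o W) (rnorm S) SWl.
  move=> z; have [->|z0] := eqVneq z 0.
    by rewrite /= -(scale0r 0) WZ linearZ /= !scale0r !rnorm0 mulr0.
  have n0 := rnorm_gt0 z0.
  have zE : z = (rnorm z)%:C *: ((rnorm z)^-1%:C *: z).
    by rewrite scalerA -rmorphM divff ?gt_eqF // scale1r.
  rewrite /= {1}zE WZ linearZ /= rnormZr ?(ltW n0) // mulrC ler_pM2r //.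
  apply: rnorm_op_ball; apply: W1.
  by rewrite rnormZr ?invr_ge0 ?(ltW n0) // mulVf ?gt_eqF.
exists T'; split.
- apply: rnorm_op_le => z z1.
  (* [W z - z] is a difference of two vectors of the unit ball vanishing on [A]; each contributes at
     most [g]. *)
  have -> : (T' - S) z = S (c0_mix A 0 (f (z i) *: x3)) - S (c0_mix A 0 z).
    rewrite [LHS](_ : _ = T' z - S z) // T'E /= -!linearB; congr (S _).
    apply: c0_eqP => n.
    rewrite [LHS](_ : _ = W z n - z n) // [RHS](_ : _ = c0_mix A 0 (f (z i) *: x3) n - c0_mix A 0 z n) //.
    by rewrite !c0_mixE; case: ifP => // _; rewrite !subrr.
  apply: le_trans (rnormD _ _) _; rewrite rnormN mulr_natl mulr2n; apply: lerD.
    apply: Sg => [|n An]; last by rewrite c0_mixE An.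
    by apply: rnorm_c0_mix; [rewrite rnorm0|exact: fz].
  apply: Sg => [|n An]; last by rewrite c0_mixE An.
  by apply: rnorm_c0_mix => //; rewrite rnorm0.
- apply: rnorm_op_le => z z1; rewrite T'E; apply: rnorm_op_ball; exact: W1.
- rewrite T'E /=; congr (S _); apply: c0_eqP => n; rewrite !c0_mixE Ai.
  case: ifP => An; first by rewrite ?c0_mixE An.
  rewrite [LHS](_ : _ = f (x3 i) *: x3 n) // fx.
  by rewrite -rnormE x3i scale1r.
Qed.

End near_maximizers.

(** * Completeness *)

Lemma exists_half_exp (R : realType) (K e : R) :
  0 < e -> exists n, K / 2 ^+ n < e.
Proof.
move=> e0; exists (Num.bound (`|K| / e)); set n := Num.bound _.
have nK : `|K| / e < n%:R by apply: archi_boundP; rewrite divr_ge0 // ltW.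
have n2 : n%:R <= 2 ^+ n :> R by rewrite -natrX ler_nat ltnW // ltn_expl.
rewrite ltr_pdivrMr ?exprn_gt0 // mulrC.
apply: le_lt_trans (ler_norm K) _; rewrite -ltr_pdivrMr //.
exact: lt_le_trans n2.
Qed.

Lemma half_exp_le (R : realType) (K r s : R) :
  (forall n, r <= s + K / 2 ^+ n) -> r <= s.
Proof.
move=> rK; rewrite leNgt; apply/negP => sr.
have [n] := @exists_half_exp R K (r - s) ltac:(by rewrite subr_gt0).
by have := rK n; lra.
Qed.

Section geometric_completeness.
Context (R : realType).

(** Completeness for geometrically decreasing increments, with the rate kept for the limit: the
    increments from stage [n] on sum to [c / 2 ^+ n]. In this form it passes coordinatewise to [c0]
    and pointwise to operators. *)
Definition geometrically_complete (V : normedModType R[i]) :=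
  forall (u : nat -> V) (c : R),
    (forall n, rnorm (u n.+1 - u n) <= c / 2 ^+ n.+1) ->
    exists l, forall n, rnorm (l - u n) <= c / 2 ^+ n.

Lemma complete_geometrically_complete (V : completeNormedModType R[i]) :
  geometrically_complete V.
Proof.
move=> u c uc.
(* The subtracted term is what makes the induction on [k] close. *)
have um n k : rnorm (u (n + k)%N - u n) <= c / 2 ^+ n - c / 2 ^+ (n + k).
  elim: k => [|k IH]; first by rewrite addn0 subrr rnorm0 subrr.
  rewrite addnS -(subrK (u (n + k)%N) (u _.+1)) -addrA.
  apply: le_trans (rnormD _ _) _.
  have -> : c / 2 ^+ (n + k).+1 = c / 2 ^+ (n + k) / 2.
    by rewrite exprSr invfM mulrA.
  have := uc (n + k)%N.
  rewrite exprSr invfM mulrA.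
  by move: (c / 2 ^+ (n + k)) IH => q; lra.
have c0 : 0 <= c.
  by have := le_trans (rnorm_ge0 _) (uc 0%N); rewrite pmulr_lge0.
have um' n m : (n <= m)%N -> rnorm (u m - u n) <= c / 2 ^+ n.
  move=> /subnKC <-; apply: le_trans (um _ _) _.
  by rewrite gerBl divr_ge0 // exprn_ge0.
have ucvg : cvg (u @ \oo).
  apply/cauchy_cvgP/cauchy_exP => eps eps0.
  have epsE : eps = (complex.Re eps)%:C.
    by move: eps0; case: eps => a b; rewrite ltcE /= => /andP[/eqP -> _].
  have epsR : 0 < complex.Re eps by rewrite -(ltcR 0) -epsE.
  have [n cn] := exists_half_exp c epsR; rewrite epsE.
  exists (u n), n => // m /= nm; rewrite -ball_normE /= -rnormE ltcR.
  by rewrite rnorm_distC; apply: le_lt_trans (um' _ _ nm) cn.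
exists (lim (u @ \oo)) => n; apply: (@half_exp_le _ 1) => k.
have e0 : 0 < 1 / 2 ^+ k :> R by rewrite divr_gt0 // exprn_gt0.
have e0' : 0 < (1 / 2 ^+ k : R)%:C by rewrite (ltcR 0).
have /cvgrPdist_le/(_ _ e0')[N _ uN] := ucvg.
have := uN (maxn n N) (leq_maxr n N); rewrite /= -rnormE lecR => H.
rewrite -(subrK (u (maxn n N)) (lim _)) -addrA.
apply: le_trans (rnormD _ _) _; rewrite [leRHS]addrC; apply: lerD => //.
by apply: um'; exact: leq_maxl.
Qed.

(** The coordinatewise limit tends to 0, being uniformly within [c / 2 ^+ k] of the null sequence
    [u k]. *)
Lemma c0_geometrically_complete (X : normedModType R[i]) :
  geometrically_complete X -> geometrically_complete (c0 X).
Proof.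
move=> gX u c uc.
have /choice[l lP] : forall i, exists l, forall n, rnorm (l - u n i) <= c / 2 ^+ n.
  move=> i; apply: gX => n; apply: le_trans (uc n).
  exact: (rnorm_c0_coord (u n.+1 - u n) i).
have l0 : l \in @c0_pred R X.
  rewrite inE; apply/cvgrPdist_le => e e0.
  have eE : e = (complex.Re e)%:C.
    by move: e0; case: e => a b; rewrite ltcE /= => /andP[/eqP -> _].
  have {e0} e0 : 0 < complex.Re e by rewrite -(ltcR 0) -eE.
  have [k ck] := @exists_half_exp _ c (complex.Re e / 2) ltac:(lra).
  have e1 : 0 < (complex.Re e / 2)%:C by rewrite (ltcR 0); lra.
  have /cvgrPdist_le/(_ _ e1)[N _ uN] := c0_cvg (u k).
  exists N => // i /= Ni; have := uN i Ni; rewrite eE.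
  rewrite /= !sub0r -!rnormE !lecR !rnormN => ui.
  rewrite -(subrK (u k i) (l i)); apply: le_trans (rnormD _ _) _.
  by have := lP i k; lra.
exists (C0 l0) => n; apply: rnorm_c0_le => i.
exact: lP.
Qed.

Lemma bounded_op_geometrically_complete (Z Y : normedModType R[i]) :
  geometrically_complete Y -> geometrically_complete (bounded_op Z Y).
Proof.
move=> gY T c Tc.
have /choice[l lP] : forall z, exists l, forall n,
    rnorm (l - T n z) <= c * rnorm z / 2 ^+ n.
  move=> z; apply: gY => n.
  apply: le_trans (rnorm_op_bound (T n.+1 - T n) z) _.
  by rewrite mulrAC; apply: ler_wpM2r; [exact: rnorm_ge0|exact: Tc].
have ll : linear l.
  move=> a z w; apply/eqP; rewrite -subr_eq0; apply/eqP/rnorm_eq0/eqP.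
  rewrite eq_le rnorm_ge0 andbT.
  (* The constant collects the errors of [T n] at [a *: z + w], at [z] scaled by [a], and at [w]. *)
  apply: (@half_exp_le _ (c * rnorm (a *: z + w) +
    complex.Re `|a| * (c * rnorm z) + c * rnorm w)) => n.
  have -> : l (a *: z + w) - (a *: l z + l w) =
      (l (a *: z + w) - T n (a *: z + w)) - a *: (l z - T n z) - (l w - T n w).
    by rewrite (linearP (T n)) scalerBr !opprB -[RHS]addrA
      [X in _ = _ + X]addrACA -[X in _ = _ + (_ + X)]opprD [RHS]addrA subrK.
  rewrite add0r !mulrDl.
  apply: le_trans (rnormD _ _) _; rewrite rnormN; apply: lerD; last exact: lP.
  apply: le_trans (rnormD _ _) _; rewrite rnormN; apply: lerD; first exact: lP.
  rewrite rnormZ -mulrA; apply: ler_wpM2l; last exact: lP.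
  by rewrite -lecR Re_normc (normr_ge0 a).
have [z|L LE] := @exists_bounded_op _ _ _ l (c + rnorm (T 0%N)) ll.
  rewrite -(subrK (T 0%N z) (l z)); apply: le_trans (rnormD _ _) _.
  rewrite mulrDl; apply: lerD; last exact: rnorm_op_bound.
  by have := lP z 0%N; rewrite expr0 divr1.
exists L => n; apply: rnorm_op_le => z z1.
rewrite [X in rnorm X](_ : _ = L z - T n z) // LE.
apply: le_trans (lP z n) _; rewrite ler_pM2r ?invr_gt0 ?exprn_gt0 //.
have c0 : 0 <= c.
  by have := le_trans (rnorm_ge0 _) (Tc 0%N); rewrite pmulr_lge0.
by rewrite ler_piMr.
Qed.

End geometric_completeness.

(** * The Bishop-Phelps-Bollobas property *)

Section approximate_step.
Context (R : realType) (X Y : normedModType R[i]).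
Context (ucX : uniformly_convex X) (cucY : C_uniformly_convex Y).

Lemma uniformly_convex_midpoint (e : R) : 0 < e ->
  exists2 d : R, 0 < d & forall x y : X, rnorm x <= 1 -> rnorm y <= 1 ->
    1 - d < rnorm (2^-1%:C *: (x + y)) -> rnorm (x - y) < e.
Proof.
move=> e0; have [d d0 H] := ucX e0; exists d => // x y x1 y1 xy.
rewrite ltNge; apply/negP => exy.
have := H x y; rewrite /unit_ball /= !norm_le1 => /(_ x1 y1).
rewrite -rnormE lecR => /(_ exy).
have -> : (2^-1 : R[i]) = 2^-1%:C by rewrite fmorphV rmorph_nat.
by rewrite -rnormE -(rmorphB (real_complex R) 1) lecR; lra.
Qed.

(** [eta] depends on [e] only, while [h] is arbitrary: the new pair can be made good enough for any
    later application of the lemma. *)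
Lemma approximate_step (e : R) : 0 < e <= 1 ->
  exists2 eta : R, 0 < eta & forall (T : bounded_op (c0 X) Y) (x : c0 X) (h : R),
    rnorm T = 1 -> rnorm x = 1 -> 1 - eta < rnorm (T x) -> 0 < h ->
    exists (T' : bounded_op (c0 X) Y) (x' : c0 X),
      [/\ rnorm T' = 1, rnorm x' = 1, 1 - h < rnorm (T' x'),
          rnorm (T' - T) <= e & rnorm (x' - x) <= e].
Proof.
move=> /andP[e0 e1].
have [d d0 dP] := @uniformly_convex_midpoint (e / 4) ltac:(lra).
(* [b <= d] activates uniform convexity on [A]; [b <= e / 8] keeps the later normalization of [x2 i]
   within [e / 4]. *)
pose b := Num.min d (e / 8).
have b0 : 0 < b by rewrite lt_min d0 /=; lra.
have bd : b <= d by rewrite ge_min lexx.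
have be : b <= e / 8 by rewrite ge_min lexx orbT.
have [|| k /andP[k0 k1] kP] := @C_uniformly_convex_off_support R X Y b (e / 64) cucY.
- by apply/andP; split; lra.
- by lra.
(* Chosen so that [5 * eta / rho = k]. *)
pose rho := e / 8; pose eta := k * rho / 5.
have rho0 : 0 < rho by rewrite /rho; lra.
have eta0 : 0 < eta by rewrite divr_gt0 // mulr_gt0.
have eta1 : eta <= 1 by rewrite /eta /rho; nra.
exists eta => // T x h T1 x1 Tx h0.
(* Normalizing a coordinate doubles [h'], and dividing by [t > 1/2] at most doubles it again. The
   cap 1/8 ensures [t > 1/2]. *)
pose h' := Num.min (h / 8) 8^-1.
have h'0 : 0 < h' by rewrite lt_min; apply/andP; split; lra.
have h'h : h' <= h / 8 by rewrite ge_min lexx.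
have h'1 : h' <= 8^-1 by rewrite ge_min lexx orbT.
have [|||S [x2 [ST S2 x21 Sx2 Tu]]] :=
  @rank_one_perturbation R _ _ T x eta rho h' _ _ h'0 T1 _ Tx.
- by rewrite eta0.
- by rewrite rho0 /rho; lra.
- by rewrite x1.
have {}Tu : 1 - k <= rnorm (T (2^-1%:C *: (x + x2))).
  apply: le_trans Tu; rewrite lerD2l lerN2 /eta.
  by have -> : 5 * (k * rho / 5) / rho = k; [field; rewrite gt_eqF | ].
set u := _ *: (x + x2) in Tu; pose A n := 1 - b < rnorm (u n).
have uE n : u n = 2^-1%:C *: (x n + x2 n) by [].
have xn n : rnorm (x n) <= 1 by rewrite -x1; exact: rnorm_c0_coord.
have x2n n : rnorm (x2 n) <= 1 by apply: le_trans x21; exact: rnorm_c0_coord.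
have u1 : rnorm u <= 1.
  apply: rnorm_c0_le => n; rewrite uE rnormZr ?invr_ge0 //.
  by have := rnormD (x n) (x2 n); have := xn n; have := x2n n; lra.
have Ty (y : c0 X) : rnorm y <= 1 -> (forall n, A n -> y n = 0) -> rnorm (T y) <= e / 64.
  by move=> y1 yA; apply: kP Tu y1 yA.
(* Otherwise [u] itself would be supported off [A], and [T u] would be small. *)
have [i Ai] : exists i, A i.
  apply: contrapT => nA; have : rnorm (T u) <= e / 64.
    by apply: Ty => // n An; case: nA; exists n.
  by lra.
have Axx2 n : A n -> rnorm (x n - x2 n) < e / 4.
  by rewrite /A uE => An; apply: dP => //; lra.
have x2i : 1 - 2 * b < rnorm (x2 i).
  move: Ai; rewrite /A uE rnormZr ?invr_ge0 //.
  by have := rnormD (x i) (x2 i); have := xn i; lra.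
have x2i0 : 0 < rnorm (x2 i) by lra.
have [x3 [x31 x3i x3n Sx3]] := normalize_coord x21 x2i0 Sx2 (ltW h'0).
have x3i1 : rnorm (x3 i) = 1.
  by rewrite x3i rnormZr ?invr_ge0 ?(ltW x2i0) // mulVf ?gt_eqF.
have x3x2 : rnorm (x3 i - x2 i) <= 2 * b.
  rewrite x3i -{3}(scale1r (x2 i)) -scalerBl -(rmorphB (real_complex R) _ 1).
  have x2i1 := x2n i.
  rewrite rnormZr ?subr_ge0 ?invf_ge1 // mulrBl mulVf ?gt_eqF // mul1r.
  by clear -x2i; lra.
have Sy (y : c0 X) : rnorm y <= 1 -> (forall n, A n -> y n = 0) -> rnorm (S y) <= e / 32.
  by move=> y1 yA; apply: le_trans (S2 y) _; have := Ty y y1 yA; lra.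
have [T' [T'S T'n T'x]] := transfer_maximizer x x31 Ai x3i1 Sy.
pose x' := c0_mix A x3 x.
have x'1 : rnorm x' <= 1 by apply: rnorm_c0_mix => //; rewrite x1.
have S1 : 1 - rho <= rnorm S.
  by have := rnormB T S; rewrite rnorm_distC T1; clear -ST; lra.
(* [rho = e / 8] from [S - T], and twice [e / 32] from the transfer. *)
have T'T : rnorm (T' - T) <= 3 * e / 16.
  rewrite -(subrK S T') -addrA; apply: le_trans (rnormD _ _) _.
  by clear -ST T'S; move: ST; rewrite /rho; lra.
have T'x' : rnorm S - 2 * h' < rnorm (T' x') by rewrite T'x.
set t := rnorm T'; have T't : rnorm (T' x') <= t by exact: rnorm_op_ball.
have t2 : 2^-1 < t by clear -S1 e1 h'1 T'x' T't; move: S1; rewrite /rho; lra.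
have t0 : 0 < t by clear -t2; lra.
have tT : `|t - 1| <= 3 * e / 16.
  have H1 := rnormB T' T; have H2 := rnormB T T'.
  rewrite (rnorm_distC T T') T1 in H2; rewrite T1 in H1.
  by clear -H1 H2 T'T; rewrite ler_norml /t; apply/andP; split; lra.
exists (t^-1%:C *: T'), x'; split.
- by rewrite rnormZr ?invr_ge0 ?(ltW t0) // mulVf ?gt_eqF.
- apply/eqP; rewrite eq_le x'1 -x3i1.
  by have := rnorm_c0_coord x' i; rewrite c0_mixE Ai.
- rewrite [X in rnorm X](_ : _ = t^-1%:C *: T' x') // rnormZr ?invr_ge0 ?(ltW t0) //.
  rewrite ltr_pdivlMl // mulrBr mulr1; have : t <= rnorm S by [].
  by clear -t2 T'x' h'h h0; nra.
- have E : t^-1%:C *: T' - T' = (t^-1 - 1)%:C *: T'.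
    by rewrite rmorphB scalerBl scale1r.
  rewrite -(subrK T' (_ *: _)) -addrA; apply: le_trans (rnormD _ _) _.
  rewrite E rnormZ normc_def /= expr0n addr0 sqrtr_sqr -/t.
  rewrite -{2}(ger0_norm (ltW t0)) -normrM mulrBl mulVf ?gt_eqF // mul1r distrC.
  by clear -tT T'T e0; lra.
- apply: rnorm_c0_le => n.
  rewrite [X in rnorm X](_ : _ = c0_mix A x3 x n - x n) // c0_mixE.
  case: ifP => [An|_]; last by rewrite subrr rnorm0 ltW.
  have := Axx2 n An; rewrite rnorm_distC.
  have [->|ni] := eqVneq n i; last by rewrite x3n //; clear -e0; lra.
  move=> H; rewrite -(subrK (x2 i) (x3 i)) -addrA.
  by apply: le_trans (rnormD _ _) _; clear -H x3x2 be e0; lra.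
Qed.

End approximate_step.

(** * Exact norm attainment by iteration *)

Section iteration.
Context (R : realType) (Z Y : normedModType R[i]).
Context (cZ : geometrically_complete Z) (cY : geometrically_complete Y).
Context (step : forall e : R, 0 < e <= 1 ->
  exists2 eta : R, 0 < eta & forall (T : bounded_op Z Y) (x : Z) (h : R),
    rnorm T = 1 -> rnorm x = 1 -> 1 - eta < rnorm (T x) -> 0 < h ->
    exists (T' : bounded_op Z Y) (x' : Z),
      [/\ rnorm T' = 1, rnorm x' = 1, 1 - h < rnorm (T' x'),
          rnorm (T' - T) <= e & rnorm (x' - x) <= e]).

(** Stage [n] moves by at most [c / 2 ^+ n.+1] and delivers the precision [thr n.+1] required by the
    next stage. The cap [1 / 2 ^+ n] in [thr] makes the limit pair attain the norm. *)
Lemma iterate_step (c : R) : 0 < c <= 1 ->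
  exists2 eta : R, 0 < eta & forall (T : bounded_op Z Y) (x : Z),
    rnorm T = 1 -> rnorm x = 1 -> 1 - eta < rnorm (T x) ->
    exists (S : bounded_op Z Y) (z : Z),
      [/\ rnorm S = 1, rnorm z = 1, rnorm (S z) = 1,
          rnorm (S - T) <= c & rnorm (z - x) <= c].
Proof.
move=> /andP[c0 c1]; pose e n : R := c / 2 ^+ n.+1.
have e01 n : 0 < e n <= 1.
  rewrite divr_gt0 ?exprn_gt0 //= ler_pdivrMr ?exprn_gt0 // mul1r.
  by apply: le_trans c1 _; rewrite exprn_ege1 ?ler1n.
have /choice[eta etaP] : forall n, exists eta : R, 0 < eta /\
    forall (T : bounded_op Z Y) (x : Z) (h : R),
    rnorm T = 1 -> rnorm x = 1 -> 1 - eta < rnorm (T x) -> 0 < h ->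
    exists (T' : bounded_op Z Y) (x' : Z),
      [/\ rnorm T' = 1, rnorm x' = 1, 1 - h < rnorm (T' x'),
          rnorm (T' - T) <= e n & rnorm (x' - x) <= e n].
  by move=> n; have [eta eta0 H] := step (e01 n); exists eta.
pose thr n := Num.min (eta n) (1 / 2 ^+ n).
have thr0 n : 0 < thr n by rewrite lt_min (etaP n).1 divr_gt0 ?exprn_gt0.
exists (thr 0%N) => // T0 x0 T01 x01 Tx0.
pose P n (p : bounded_op Z Y * Z) :=
  [/\ rnorm p.1 = 1, rnorm p.2 = 1 & 1 - thr n < rnorm (p.1 p.2)].
(* Guarding by [P] makes the relation total, as dependent choice requires; the state carries its own
   stage number. *)
pose rel (s t : nat * (bounded_op Z Y * Z)) := P s.1 s.2 ->
  [/\ t.1 = s.1.+1, P t.1 t.2, rnorm (t.2.1 - s.2.1) <= e s.1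
    & rnorm (t.2.2 - s.2.2) <= e s.1].
have relP s : {t | rel s t}.
  apply: cid; case: s => n [T x]; have [[/= T1 x1 Tx]|nP] := pselect (P n (T, x)); last first.
    by exists (n, (T, x)) => /nP.
  have [|T' [x' [T'1 x'1 T'x' T'T x'x]]] := (etaP n).2 T x (thr n.+1) T1 x1 _ (thr0 _).
    by apply: le_lt_trans Tx; rewrite lerB // ge_min lexx.
  by exists (n.+1, (T', x')).
have [f [f0 fS]] := dependent_choice relP (0%N, (T0, x0)).
have fP n : (f n).1 = n /\ P (f n).1 (f n).2.
  elim: n => [|n [IH1 IH2]]; first by rewrite f0.
  by have [H1 H2 _ _] := fS n IH2; rewrite H1 IH1 in H2 *.
pose T n := (f n).2.1; pose x n := (f n).2.2.
have Pn n : [/\ rnorm (T n) = 1, rnorm (x n) = 1 & 1 - thr n < rnorm (T n (x n))].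
  by have [H] := fP n; rewrite H.
have [|S SP] := bounded_op_geometrically_complete cY (u := T) (c := c).
  by move=> n; have [_ _] := fS n (fP n).2; rewrite (fP n).1.
have [|z zP] := cZ (u := x) (c := c).
  by move=> n; have [_ _ _] := fS n (fP n).2; rewrite (fP n).1.
have lim1 (V : normedModType R[i]) (l : V) v :
    (forall n, rnorm (v n) = 1) -> (forall n, rnorm (l - v n) <= c / 2 ^+ n) ->
    rnorm l = 1.
  move=> v1 lv; apply/eqP; rewrite eq_le; apply/andP; split.
    apply: (@half_exp_le _ c) => n.
    by have := rnormB l (v n); have := lv n; rewrite v1; lra.
  apply: (@half_exp_le _ c) => n.
  by have := rnormB (v n) l; rewrite rnorm_distC; have := lv n; rewrite v1; lra.
have S1 : rnorm S = 1 by apply: (lim1 _ _ T) => // n; case: (Pn n).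
have z1 : rnorm z = 1 by apply: (lim1 _ _ x) => // n; case: (Pn n).
exists S, z; split=> //.
- apply/eqP; rewrite eq_le -{1}S1 rnorm_op_ball ?z1 //=.
  (* The 1 comes from [thr n], and the two [c] from replacing [T n] by [S] and [x n] by [z]. *)
  apply: (@half_exp_le _ (1 + 2 * c)) => n.
  have [T1 x1 Tx] := Pn n.
  have H1 : thr n <= 1 / 2 ^+ n by rewrite ge_min lexx orbT.
  have H2 : rnorm (T n (x n)) <= rnorm (S z) + rnorm (S z - T n (x n)).
    by have := rnormB (T n (x n)) (S z); rewrite rnorm_distC; lra.
  have H3 : rnorm (S z - T n (x n)) <= c / 2 ^+ n + c / 2 ^+ n.
    have -> : S z - T n (x n) = (S - T n) z + T n (z - x n).
      by rewrite [(S - T n) z](_ : _ = S z - T n z) // linearB addrA subrK.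
    apply: le_trans (rnormD _ _) _; apply: lerD.
      by apply: le_trans (SP n); apply: rnorm_op_ball; rewrite z1.
    by apply: le_trans (zP n); apply: le_trans (rnorm_op_bound _ _) _; rewrite T1 mul1r.
  by rewrite mulrDl -mulrA; lra.
- by have := SP 0%N; rewrite /T f0 expr0 divr1.
- by have := zP 0%N; rewrite /x f0 expr0 divr1.
Qed.

End iteration.

Theorem theorem2p4 (R : realType) (X Y : completeNormedModType R[i])
    (ucX : uniformly_convex X) (cucY : C_uniformly_convex Y) :
  BPB_property (c0 X) Y.
Proof.
(* Halving [e] turns the non-strict bounds into strict ones; the cap 1 meets the range of the
   iteration. *)
move=> e e0; pose c := Num.min (e / 2) 1.
have c01 : 0 < c <= 1 by rewrite lt_min ge_min lexx orbT ltr01 !andbT; lra.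
have ce : c < e by rewrite gt_min; apply/orP; left; lra.
have cX := c0_geometrically_complete (complete_geometrically_complete (V := X)).
have cY := complete_geometrically_complete (V := Y).
have [eta eta0 H] := iterate_step cX cY (approximate_step ucX cucY) c01.
exists eta => // T x0 /norm_eq1 T1 /norm_eq1 x01.
rewrite -rnormE -(rmorphB (real_complex R) 1) ltcR => Tx.
have [S [z [S1 z1 Sz ST zx]]] := H T x0 T1 x01 Tx.
exists S, z; split; [exact/norm_eq1|exact/norm_eq1|exact/norm_eq1| |].
- by rewrite -rnormE ltcR; apply: le_lt_trans ce.
- by rewrite -rnormE ltcR; apply: le_lt_trans ce.
Qed.
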